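(* Let $1\le p<\infty$, let $(X,\mathcal B,\mu)$ be a $\sigma$-finite measure space such that $L^p(X)=L^p(X,\mathcal B,\mu)$ is separable, and let $T_f:L^p(X)\to L^p(X)$, $T_f(\varphi)=\varphi\circ f$, be a dissipative composition operator. Then $T_f$ is hypercyclic if and only if $T_f$ is recurrent.
   Context: Composition operator: let $(X,\mathcal B,\mu)$ be a $\sigma$-finite measure space and $f:X\to X$ a bijective bimeasurable map (both $f$ and $f^{-1}$ are measurable) such that both $f$ and $f^{-1}$ satisfy the following condition: for $g=f$ and for $g=f^{-1}$ there is a constant $c_g>0$ with $\mu(g^{-1}(B))\le c_g\,\mu(B)$ for every $B\in\mathcal B$. For $1\le p<\infty$ the composition operator induced by $f$ is the bounded linear operator $T_f:L^p(X)\to L^p(X)$, $\varphi\mapsto\varphi\circ f$; it is invertible with $T_f^{-1}=T_{f^{-1}}$. Dissipative: $T_f$ is dissipative if there exists $W\in\mathcal B$ with $0<\mu(W)<\infty$ such that $X=\dot\bigcup_{k\in\mathbb Z}f^k(W)$ (disjoint union). Let $T:E\to E$ be a bounded linear operator on a separable Banach space $E$. A vector $x\in E$ is recurrent for $T$ if there is a strictly increasing sequence $(n_k)_{k}$ of positive integers with $T^{n_k}x\to x$ as $k\to\infty$. The operator $T$ is recurrent if its set of recurrent vectors is dense in $E$. The operator $T$ is hypercyclic if there is $x\in E$ whose orbit $\{T^n x:n\in\mathbb N\}$ is dense in $E$, where $\mathbb N=\{1,2,\dots\}$. *)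

(* Defs.v *)
From HB Require Import structures.
From mathcomp Require Import all_boot all_order all_algebra.
From mathcomp Require Import generic_quotient ring_quotient complex.
From mathcomp Require Import all_classical all_reals all_analysis.
From mathcomp Require Import measurable_realfun.


Set Implicit Arguments.
Unset Strict Implicit.
Unset Printing Implicit Defensive.

Import Order.TTheory GRing.Theory Num.Theory.
Import numFieldNormedType.Exports.
Export Quotient.Exports.

Local Open Scope classical_set_scope.
Local Open Scope ring_scope.
Local Open Scope quotient_scope.

(* The scalar field is left open by the notation L^p(X): it is a parameter,
   either the field of real numbers or that of complex numbers.  Complex
   numbers are taken with their structure of real normed space
   (Rcomplex); only the metric of L^p matters for the notions below. *)
Variant scalars := Reals | Complexes.

Section scalars.
Context (R : realType).

Definition scalar (K : scalars) : lmodType R :=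
  match K with Reals => R^o | Complexes => Rcomplex R end.

Definition modulus (K : scalars) : scalar K -> R :=
  match K return scalar K -> R with
  | Reals => fun x : R => `|x|
  | Complexes => fun z : Rcomplex R => `|z|
  end.

Definition smeasurable d (T : measurableType d) (K : scalars) :
    set (T -> scalar K) :=
  match K return set (T -> scalar K) with
  | Reals => fun u : T -> R => measurable_fun setT u
  | Complexes => fun u : T -> Rcomplex R =>
      measurable_fun setT (fun t => complex.Re (u t)) /\
      measurable_fun setT (fun t => complex.Im (u t))
  end.
Arguments smeasurable {d T K}.

Section theory.
Context (K : scalars).
Implicit Types x y : scalar K.

Lemma modulus_ge0 x : 0 <= modulus x.
Proof. by case: K x => x /=; exact: normr_ge0. Qed.

Lemma modulus0 : modulus (0 : scalar K) = 0.
Proof. by case: K => /=; [exact: normr0|exact: (@normr0 _ (Rcomplex R))]. Qed.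

Lemma modulusD x y : modulus (x + y) <= modulus x + modulus y.
Proof. by case: K x y => x y /=; exact: ler_normD. Qed.

Lemma modulusZ (a : R) x : modulus (a *: x) = `|a| * modulus x.
Proof.
case: K x => [x|[x y]] /=; first exact: normrM.
rewrite /Num.norm /= /ComplexField.Normc.normc /=.
by rewrite !exprMn -mulrDr Num.Theory.sqrtrM ?sqr_ge0// sqrtr_sqr.
Qed.

Lemma modulus_eq0 x : modulus x = 0 -> x = 0.
Proof.
by case: K x => x /=; [exact: normr0_eq0|exact: (@normr0_eq0 _ (Rcomplex R))].
Qed.

Context d (T : measurableType d).
Implicit Types u v : T -> scalar K.

Lemma smeasurable0 : smeasurable (0 : T -> scalar K).
Proof. by case: K => /=; [|split]; exact: measurable_cst. Qed.

Lemma smeasurableD u v : smeasurable u -> smeasurable v -> smeasurable (u + v).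
Proof.
case: K u v => u v /=; first exact: measurable_funD.
move=> [ru iu] [rv iv]; split.
- rewrite (_ : (fun _ => _) =
    (fun t => complex.Re (u t)) \+ (fun t => complex.Re (v t))).
    exact: measurable_funD.
  by apply/funext => t /=; rewrite -[(u + v) t]/(u t + v t); case: (u t) (v t) => ? ? [].
- rewrite (_ : (fun _ => _) =
    (fun t => complex.Im (u t)) \+ (fun t => complex.Im (v t))).
    exact: measurable_funD.
  by apply/funext => t /=; rewrite -[(u + v) t]/(u t + v t); case: (u t) (v t) => ? ? [].
Qed.

Lemma smeasurableZ (a : R) u : smeasurable u -> smeasurable (a *: u).
Proof.
case: K u => u /=; first by move=> mu; exact: measurable_funM.
move=> [ru iu]; split.
- rewrite (_ : (fun _ => _) = (cst a \* (fun t => complex.Re (u t)))).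
    exact: measurable_funM.
  by apply/funext => t /=; rewrite -[(a *: u) t]/(a *: u t); case: (u t).
- rewrite (_ : (fun _ => _) = (cst a \* (fun t => complex.Im (u t)))).
    exact: measurable_funM.
  by apply/funext => t /=; rewrite -[(a *: u) t]/(a *: u t); case: (u t).
Qed.

Lemma smeasurable_comp (f : T -> T) u :
  measurable_fun setT f -> smeasurable u -> smeasurable (u \o f).
Proof.
move=> mf; case: K u => u /=; first by move=> mu; exact: measurableT_comp.
by move=> [ru iu]; split; [exact: (measurableT_comp ru mf)|
                           exact: (measurableT_comp iu mf)].
Qed.

Lemma measurable_modulus u : smeasurable u -> measurable_fun setT (@modulus K \o u).
Proof.
case: K u => u /=; first by move=> mu; exact: measurableT_comp.
move=> [ru iu].
rewrite (_ : _ \o _ = Num.sqrt \o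
    ((fun t => complex.Re (u t) ^+ 2) \+ (fun t => complex.Im (u t) ^+ 2))).
  apply: measurableT_comp.
    by apply: continuous_measurable_fun; exact: sqrt_continuous.
  by apply: measurable_funD; exact: measurable_funX.
by apply/funext => t /=; rewrite /Num.norm /= /ComplexField.Normc.normc; case: (u t).
Qed.

End theory.
End scalars.
Arguments smeasurable {R d T K}.

Section Lp.
Context (R : realType) (K : scalars) d (T : measurableType d).
Context (mu : {measure set T -> \bar R}) (p : R).

Definition pnorm (u : T -> scalar R K) : \bar R :=
  ('N[mu]_p%:E[EFin \o (@modulus R K \o u)])%E.

Definition pintegrable : {pred T -> scalar R K} :=
  mem [set u | smeasurable u /\ (pnorm u < +oo)%E].

Section pnorm_theory.
Hypothesis p1 : 1 <= p.
Implicit Types u v : T -> scalar R K.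

Let p0 : 0 < p. Proof. exact: lt_le_trans p1. Qed.

Lemma pnorm_ge0 u : (0 <= pnorm u)%E. Proof. exact: Lnorm_ge0. Qed.

Lemma pnormE u : pnorm u =
  ((\int[mu]_x (modulus (u x) `^ p)%:E) `^ p^-1)%E.
Proof.
rewrite /pnorm unlock; congr (_ `^ _)%E; apply: eq_integral => x _ /=.
by rewrite ger0_norm ?modulus_ge0.
Qed.

Lemma measurable_modulus_powR u : smeasurable u ->
  measurable_fun setT (fun x => (modulus (u x) `^ p)%:E).
Proof.
move=> mu'; apply/measurable_EFinP.
apply: (@measurableT_comp _ _ _ _ _ _ (fun x : R => x `^ p)).
  exact: measurable_powR.
exact: measurable_modulus mu'.
Qed.

Lemma pnormD u v : smeasurable u -> smeasurable v ->
  (pnorm (u + v)%R <= pnorm u + pnorm v)%E.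
Proof.
move=> mu' mv.
have := @eminkowski _ _ _ mu (@modulus R K \o u) (@modulus R K \o v) p%:E
  (measurable_modulus mu') (measurable_modulus mv) p1.
apply: le_trans; rewrite pnormE unlock.
apply: gt0_ler_poweR; rewrite ?in_itv /= ?leey ?andbT.
- by rewrite invr_ge0 ltW.
- by apply: integral_ge0 => x _; rewrite lee_fin powR_ge0.
- by apply: integral_ge0 => x _; rewrite lee_fin powR_ge0.
apply: ge0_le_integral => //=.
- by move=> x _; rewrite lee_fin powR_ge0.
- by apply: measurable_modulus_powR; exact: smeasurableD.
- apply/measurable_EFinP.
  apply: (@measurableT_comp _ _ _ _ _ _ (fun x : R => x `^ p)).
    exact: measurable_powR.
  by apply: measurableT_comp => //; apply: measurable_funD;
    exact: measurable_modulus.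
move=> x _; rewrite lee_fin ger0_norm ?addr_ge0 ?modulus_ge0//.
apply: ge0_ler_powR; rewrite ?nnegrE ?addr_ge0 ?modulus_ge0 ?(ltW p0)//.
exact: modulusD.
Qed.

Lemma pnormZ (a : R) u : smeasurable u -> pnorm (a *: u) = (`|a|%:E * pnorm u)%E.
Proof.
move=> mu'; rewrite !pnormE.
rewrite (_ : (\int[mu]_x _)%E =
    ((`|a| `^ p)%:E * \int[mu]_x (modulus (u x) `^ p)%:E)%E); last first.
  rewrite -ge0_integralZl//; last 2 first.
  - exact: measurable_modulus_powR.
  - by move=> x _; rewrite lee_fin powR_ge0.
  by apply: eq_integral => x _; rewrite modulusZ powRM ?modulus_ge0.
rewrite poweRM; last 2 first.
- by rewrite lee_fin powR_ge0.
- by apply: integral_ge0 => x _; rewrite lee_fin powR_ge0.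
by rewrite poweR_EFin -powRrM mulfV ?gt_eqF// powRr1.
Qed.

Lemma pnorm_eq0 u : smeasurable u ->
  pnorm u = 0%E <-> \forall x \ae mu, u x = 0.
Proof.
move=> mu'; split=> [u0|u0].
  have /(_ _ _ u0) := @Lnorm_eq0_eq0 _ _ _ mu (EFin \o (@modulus R K \o u)) p%:E.
  rewrite lte_fin p0 => /(_ _ isT); have /measurable_EFinP := measurable_modulus mu'.
  by move=> /[swap] /[apply]; apply: filterS => x /(_ I) [] /modulus_eq0.
rewrite pnormE (@ge0_ae_eq_integral _ _ _ mu setT _ (cst 0%E)) //.
- by rewrite integral0 poweR0r// invr_neq0// gt_eqF.
- exact: measurable_modulus_powR.
- by move=> x _; rewrite lee_fin powR_ge0.
- by apply: filterS u0 => x ux0 _; rewrite ux0 modulus0 powR0// gt_eqF.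
Qed.

Lemma pintegrable_submod_closed : submod_closed pintegrable.
Proof.
split.
  rewrite inE; split; first exact: smeasurable0.
  have /(pnorm_eq0 (smeasurable0 _ _ _)) -> // : \forall x \ae mu, (0 : T -> scalar R K) x = 0.
  exact/nearW.
move=> a u v; rewrite !inE => -[mu' fu] [mv fv].
have mau := smeasurableZ a mu'.
split; first exact: smeasurableD.
apply: le_lt_trans (pnormD mau mv) _.
by rewrite lte_add_pinfty// pnormZ// lte_mul_pinfty// lee_fin.
Qed.

End pnorm_theory.

(* p1 is a phantom parameter: the vector space structure depends on it. *)
Record pfun (p1 : 1 <= p) :=
  Pfun { pfun_fun :> T -> scalar R K; pfun_in : pfun_fun \in pintegrable }.

Section quotient.
Context (p1 : 1 <= p).

HB.instance Definition _ := GRing.isSubmodClosed.Build R (T -> scalar R K)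
  pintegrable (pintegrable_submod_closed p1).

HB.instance Definition _ := [isSub for @pfun_fun p1].
HB.instance Definition _ := [Choice of pfun p1 by <:].
HB.instance Definition _ := [SubChoice_isSubLmodule of pfun p1 by <:].

Implicit Types u v : pfun p1.

Lemma pfun_meas u : smeasurable (u : T -> scalar R K).
Proof. by have := pfun_in u; rewrite inE => -[]. Qed.

Lemma pfun_fin_num u : pnorm u \is a fin_num.
Proof.
by have := pfun_in u; rewrite inE ge0_fin_numE ?pnorm_ge0// => -[].
Qed.

Definition ae_null : {pred pfun p1} := 
  mem [set u : pfun p1 | \forall x \ae mu, u x = 0].

Lemma ae_null_submod_closed : submod_closed ae_null.
Proof.
split; first by rewrite inE; exact/nearW.
move=> a u v; rewrite !inE; apply: filterS2 => x ux vx.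
by rewrite -[LHS]/(a *: u x + v x) ux vx scaler0 addr0.
Qed.

HB.instance Definition _ := GRing.isSubmodClosed.Build R (pfun p1)
  ae_null ae_null_submod_closed.

(* Functions modulo equality almost everywhere, see Lp_eqP. *)
Definition Lp : Type := Quotient.quot ae_null.

HB.instance Definition _ := GRing.Zmodule.on Lp.
HB.instance Definition _ := EqQuotient.on Lp.

Lemma Lp_eqP u v : \pi_Lp u = \pi_Lp v <-> \forall x \ae mu, u x = v x.
Proof.
have -> : (\pi_Lp u = \pi_Lp v) <-> u - v \in ae_null.
  by rewrite Quotient.idealrBE; split=> [->|/eqP].
rewrite inE; split; apply: filterS => x; rewrite -[(u - v) x]/(u x - v x).
  by move/eqP; rewrite subr_eq0 => /eqP.
by move=> ->; rewrite subrr.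
Qed.

Lemma repr_Lp u : \forall x \ae mu, (repr (\pi_Lp u)) x = u x.
Proof. by apply/Lp_eqP; rewrite reprK. Qed.

Lemma piLpD u v : \pi_Lp (u + v) = \pi_Lp u + \pi_Lp v.
Proof. exact: Quotient.pi_add. Qed.

Lemma piLp0 : \pi_Lp 0 = 0.
Proof. by apply: (addIr (\pi_Lp 0)); rewrite -piLpD !add0r. Qed.

Definition scaleLp (a : R) (x : Lp) : Lp := \pi_Lp (a *: repr x).

Lemma scaleLpE a u : scaleLp a (\pi_Lp u) = \pi_Lp (a *: u).
Proof.
apply/Lp_eqP; apply: filterS (repr_Lp u) => x ux.
by rewrite -[LHS]/(a *: repr (\pi_Lp u) x) ux.
Qed.

Lemma scaleLpA a b x : scaleLp a (scaleLp b x) = scaleLp (a * b) x.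
Proof. by rewrite -[x]reprK (scaleLpE b) !scaleLpE scalerA. Qed.

Lemma scaleLp1 : left_id 1 scaleLp.
Proof. by move=> x; rewrite -[x]reprK !scaleLpE scale1r. Qed.

Lemma scaleLpDr : right_distributive scaleLp +%R.
Proof.
by move=> a x y; rewrite -[x]reprK -[y]reprK -piLpD !scaleLpE -piLpD scalerDr.
Qed.

Lemma scaleLpDl x : {morph scaleLp^~ x : a b / a + b}.
Proof. by move=> a b; rewrite -[x]reprK !scaleLpE -piLpD scalerDl. Qed.

HB.instance Definition _ := GRing.Zmodule_isLmodule.Build R Lp
  scaleLpA scaleLp1 scaleLpDr scaleLpDl.

Definition normLp (x : Lp) : R := fine (pnorm (repr x)).

Lemma normLpE u : normLp (\pi_Lp u) = fine (pnorm u).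
Proof.
rewrite /normLp !pnormE//; congr (fine (_ `^ _)%E).
apply: ge0_ae_eq_integral => //.
- exact/measurable_modulus_powR/pfun_meas.
- exact/measurable_modulus_powR/pfun_meas.
- by move=> x _; rewrite lee_fin powR_ge0.
- by move=> x _; rewrite lee_fin powR_ge0.
by apply: filterS (repr_Lp u) => x -> _.
Qed.

Lemma normLpD x y : normLp (x + y) <= normLp x + normLp y.
Proof.
rewrite -[x]reprK -[y]reprK -piLpD !normLpE -fineD ?pfun_fin_num//.
rewrite fine_le ?pfun_fin_num ?fin_numD ?pfun_fin_num//.
exact: pnormD (pfun_meas _) (pfun_meas _).
Qed.

Lemma normLpZ a x : normLp (a *: x) = `|a| * normLp x.
Proof.
rewrite -[x]reprK -[a *: _]/(scaleLp _ _) scaleLpE !normLpE.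
rewrite -[`|a|]/(fine `|a|%:E) -fineM ?pfun_fin_num//.
by rewrite -(pnormZ p1 _ (pfun_meas _)).
Qed.

Lemma normLp0_eq0 x : normLp x = 0 -> x = 0.
Proof.
rewrite -[x]reprK normLpE => u0.
rewrite -piLp0; apply/Lp_eqP.
apply/(pnorm_eq0 p1 (pfun_meas _)).
by rewrite -[LHS]fineK ?pfun_fin_num// u0.
Qed.

HB.instance Definition _ := Lmodule_isNormed.Build R Lp
  normLpD normLpZ normLp0_eq0.

End quotient.

Definition bounded_preimage (f : T -> T) :=
  measurable_fun setT f /\
  exists2 c : R, 0 < c &
    forall B, measurable B -> (mu (f @^-1` B) <= c%:E * mu B)%E.

Section composition.
Context (p1 : 1 <= p) (f : T -> T) (hf : bounded_preimage f).

Lemma pnorm_comp : exists2 c : R, 0 < c &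
  forall u : T -> scalar R K, smeasurable u ->
    (pnorm (u \o f) <= c%:E * pnorm u)%E.
Proof.
have [mf [c c0 fc]] := hf; exists (c `^ p^-1); first exact: powR_gt0.
move=> u mu'.
pose mfun_f : {mfun T >-> T} := HB.pack f (isMeasurableFun.Build _ _ _ _ f mf).
pose h x := (modulus (u x) `^ p)%:E.
have mh : measurable_fun setT h by exact: measurable_modulus_powR.
have h0 x : (0 <= h x)%E by rewrite lee_fin powR_ge0.
have hle : (\int[mu]_x h (f x) <= c%:E * \int[mu]_x h x)%E.
  rewrite -(@ge0_integral_pushforward _ _ _ _ _ _ mf mu setT h)//.
  have cE : c%:E = (NngNum (ltW c0))%:num%:E by [].
  rewrite [X in (_ <= X * _)%E]cE -ge0_integral_mscale//.
  apply: (@ge0_le_measure_integral _ _ _ (pushforward mu mfun_f)) => //.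
rewrite !pnormE -poweR_EFin -poweRM ?lee_fin ?(ltW c0)//; last first.
  by apply: integral_ge0 => x _; exact: h0.
apply: gt0_ler_poweR => //; rewrite ?in_itv /= ?leey ?andbT.
- by rewrite invr_ge0 (le_trans ler01).
- by apply: integral_ge0 => x _; exact: (h0 (f x)).
- by apply: mule_ge0; [rewrite lee_fin ltW|apply: integral_ge0 => x _; exact: h0].
Qed.

Lemma comp_pintegrable (u : pfun p1) : (u : T -> scalar R K) \o f \in pintegrable.
Proof.
have [mf _] := hf; have [c c0 hc] := pnorm_comp.
rewrite inE; split; first exact: smeasurable_comp (pfun_meas u).
apply: le_lt_trans (hc _ (pfun_meas u)) _.
rewrite lte_mul_pinfty ?lee_fin ?(ltW c0)//.
by rewrite ltey_eq pfun_fin_num.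
Qed.

Definition comp_fun (u : pfun p1) : pfun p1 := Pfun p1 (comp_pintegrable u).

Definition comp_op (x : Lp p1) : Lp p1 := \pi_(Lp p1) (comp_fun (repr x)).

Lemma comp_opE (u : pfun p1) :
  comp_op (\pi_(Lp p1) u) = \pi_(Lp p1) (comp_fun u).
Proof.
have [mf [c c0 fc]] := hf; apply/Lp_eqP.
have [N [mN N0 hN]] := repr_Lp u.
exists (f @^-1` N); split.
- by rewrite -[X in measurable X]setTI; exact: mf.
- by apply/eqP; rewrite eq_le measure_ge0 andbT (le_trans (fc _ mN))// N0 mule0.
- by move=> x /= hx; exact: hN.
Qed.

Lemma comp_op_is_linear : linear comp_op.
Proof.
move=> a x y; rewrite -[x]reprK -[y]reprK.
rewrite -[a *: \pi_(Lp p1) _]/(scaleLp _ _) scaleLpE -piLpD !comp_opE.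
rewrite -[a *: \pi_(Lp p1) _]/(scaleLp _ _) scaleLpE -piLpD.
by apply/Lp_eqP; exact/nearW.
Qed.

Lemma comp_op_bounded : exists M : R, forall x, `|comp_op x| <= M * `|x|.
Proof.
have [c c0 hc] := pnorm_comp; exists c => x; rewrite -[x]reprK comp_opE.
rewrite -[`|_|]/(normLp _) -[X in _ * X]/(normLp _) !normLpE.
rewrite -lee_fin EFinM !fineK ?pfun_fin_num//.
exact: hc (pfun_meas _).
Qed.

End composition.

(* The set f^k(W), with finv standing for the inverse of f. *)
Definition zimage (f finv : T -> T) (k : int) (W : set T) : set T :=
  match k with
  | Posz n => iter n f @` W
  | Negz n => iter n.+1 finv @` W
  end.

Definition dissipative (f finv : T -> T) :=
  exists W : set T, [/\ measurable W, (0 < mu W)%E, (mu W < +oo)%E,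
    trivIset setT (fun k : int => zimage f finv k W) &
    \bigcup_(k in [set: int]) zimage f finv k W = setT].

End Lp.

Arguments Lp {R} K {d T} mu {p} p1.
Arguments comp_op {R} K {d T mu p} p1 {f} hf x.

Definition separable (E : topologicalType) :=
  exists2 D : set E, countable D & dense D.

Section dynamics.
Context (R : realType) (E : normedModType R) (A : E -> E).

Definition recurrent_vector (x : E) :=
  exists n : nat -> nat, [/\ {homo n : i j / (i < j)%N},
    forall k, (0 < n k)%N & iter (n k) A x @[k --> \oo] --> x].

Definition recurrent := dense [set x | recurrent_vector x].

Definition hypercyclic :=
  exists x, dense [set iter n A x | n in [set n | (0 < n)%N]].

End dynamics.

(* Main.v *)
Require Import Defs.
From HB Require Import structures.
From mathcomp Require Import all_boot all_order all_algebra.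
From mathcomp Require Import generic_quotient complex measurable_realfun.
From mathcomp Require Import all_classical all_reals all_analysis.
From mathcomp Require Import zify ring lra.

(** Hypercyclic implies recurrent because every point of a dense orbit is
    recurrent.  Conversely, exhaust X by the sets E_N, the unions of the images
    f^k(W) with -N <= k < N; then E_N and f^n(E_N) are disjoint for large n.
    Approximate the indicator of E_N by a recurrent vector u, and choose n large
    with u o f^n close to u.  On most of E_N both |u| and |u o f^n| are at least
    1/2; let B be the set of such points.  Outside E_N both u and u o f^n are
    small in norm, whereas |u| is at least 1/2 on f^n(B) and |u o f^n| is at
    least 1/2 on f^{-n}(B).  So f^n(B) and f^{-n}(B) have small measure
    (Chebyshev), and for bounded phi, psi supported in E_N the vector
    phi 1_B + (psi 1_B) o f^{-n} is close to phi while its image under T^n is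
    close to psi.  Hence T is transitive, and Baire's theorem applies, L^p being
    complete. *)

Set Implicit Arguments.
Unset Strict Implicit.
Unset Printing Implicit Defensive.

Import Order.TTheory GRing.Theory Num.Theory.
Import numFieldNormedType.Exports.
Local Open Scope classical_set_scope.
Local Open Scope ring_scope.
Local Open Scope quotient_scope.

(** * Recurrence, transitivity and hypercyclicity *)

Section dynamics_theory.
Context (R : realType).

Lemma denseP (E : normedModType R) (D : set E) :
  dense D <-> forall y e, 0 < e -> exists2 x, D x & `|x - y| < e.
Proof.
split=> [dD y e e0|H O [y Oy] oO].
  have [|x [yx Dx]] := dD _ _ (ball_open y e).
    by exists y; exact: ballxx.
  exists x => //; move: yx; rewrite -ball_normE /= distrC //.
have /nbhs_ballP[e /= e0 yO] : nbhs y O by exact: open_nbhs_nbhs.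
have [x Dx xy] := H y e e0; exists x; split=> //; apply: yO.
by rewrite -ball_normE /= distrC.
Qed.

(** Near returns at arbitrarily late times are enough: choosing each one after the previous one,
    with error below 1/(k+1), produces the strictly increasing sequence. *)
Lemma recurrent_vectorP (E : normedModType R) (A : E -> E) x :
  recurrent_vector A x <->
  forall e N, 0 < e -> exists2 n, (N < n)%N & `|iter n A x - x| < e.
Proof.
split=> [[n [n_incr n0 /cvgrPdist_lt nx]] e N e0|H].
  have n_ge k : (k < n k)%N.
    by elim: k => // k ih; rewrite (leq_ltn_trans ih)// n_incr.
  have [M _ HM] := nx e e0; exists (n (maxn M N)).
    by rewrite (leq_ltn_trans (leq_maxr M N)).
  by rewrite distrC; apply: HM => /=; exact: leq_maxl.
have /choice[next nextP] (k : nat * nat) : exists m,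
    (k.2 < m)%N /\ `|iter m A x - x| < k.1.+1%:R^-1.
  have [|n kn nx] := H (k.1.+1%:R^-1) k.2; first by rewrite invr_gt0.
  by exists n.
(* Starting at 0 makes every [s k.+1] positive, so the return times are read off from index 1 on. *)
pose fix s k : nat := if k is k'.+1 then next (k', s k') else 0%N.
have sP k : (s k < s k.+1)%N /\ `|iter (s k.+1) A x - x| < k.+1%:R^-1.
  exact: nextP (k, s k).
exists (fun k => s k.+1); split.
- apply: (homo_ltn ltn_trans) => k; exact: (sP k.+1).1.
- by move=> k; exact: leq_ltn_trans (sP k).1.
- apply/cvgrPdist_lt => e e0.
  near=> k; rewrite distrC; apply: (lt_le_trans (sP k).2).
  rewrite -[e]invrK lef_pV2 ?posrE ?invr_gt0//.
  rewrite (@le_trans _ _ k%:R) ?ler_nat//.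
  near: k; exact: nbhs_infty_ger.
Unshelve. all: by end_near. Qed.

(** In a nonzero space a dense orbit meets every ball at arbitrarily late times; hence A^n x comes
    close to A^m x with n far beyond m, a return of A^m x after n - m steps. The zero space is
    treated apart. *)
Lemma hypercyclic_recurrent (E : normedModType R) (A : E -> E) :
  hypercyclic A -> recurrent A.
Proof.
move=> [x /denseP xD]; apply/denseP => y e e0.
have [[v v0]|noE] := pselect (exists v : E, v != 0); last first.
  have E0 (z : E) : z = 0 by apply/eqP/negP => /negP z0; apply: noE; exists z.
  exists y; last by rewrite subrr normr0.
  apply/recurrent_vectorP => e' N e'0; exists N.+1 => //.
  by rewrite (E0 (_ - _)) normr0.
(* Induction on N: to exclude the further time N+1, aim at a point z' near z other than that orbit
   point, with a radius no larger than their distance. *)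
have away N : forall z r, 0 < r -> exists2 n, (N < n)%N & `|iter n A x - z| < r.
  elim: N => [|N ih] z r r0.
    by have [_ [n n0 <-] ?] := xD z r r0; exists n.
  have [z' [z'z z'N]] : exists z', `|z' - z| < r / 2 /\ z' != iter N.+1 A x.
    have [zN|zN] := eqVneq z (iter N.+1 A x); last first.
      by exists z; rewrite subrr normr0 divr_gt0.
    exists (z + (r / 4 / `|v|) *: v); split.
      rewrite addrC addKr normrZ normrM normfV normr_id divfK ?normr_eq0//.
      by rewrite gtr0_norm ?divr_gt0// ltr_pM2l// ltf_pV2 ?posrE// ltr_nat.
    rewrite -zN -subr_eq0 addrC addKr scaler_eq0 negb_or v0 andbT.
    by rewrite gt_eqF// !divr_gt0// normr_gt0.
  pose q := Num.min (r / 2) `|z' - iter N.+1 A x|.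
  have q0 : 0 < q by rewrite lt_min divr_gt0// normr_gt0 subr_eq0.
  have [n Nn nz'] := ih z' q q0.
  exists n.
    rewrite ltn_neqAle Nn andbT; apply/eqP => nN; move: nz'.
    by rewrite -nN distrC lt_min ltxx andbF.
  rewrite (splitr r) (le_lt_trans (ler_distD z' _ _))// ltrD//.
  by move: nz'; rewrite lt_min => /andP[].
have [_ [m _ <-] my] := xD y e e0; exists (iter m A x) => //.
apply/recurrent_vectorP => r N r0.
have [n Nn nx] := away (N + m)%N (iter m A x) r r0.
have mn : (m <= n)%N by rewrite (leq_trans _ (ltnW Nn))// leq_addl.
exists (n - m)%N; first by rewrite ltn_subRL addnC.
by rewrite -iterD subnK.
Qed.

Lemma bounded_additive_continuous (E : normedModType R) (A : E -> E) M :
  {morph A : x y / x - y} -> (forall x, `|A x| <= M * `|x|) -> continuous A.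
Proof.
move=> AB AM x; apply/cvgrPdist_lt => e e0.
have M0 : 0 < `|M| + 1 by rewrite ltr_wpDl.
near=> y.
rewrite -AB (le_lt_trans (AM _))//.
apply: (@le_lt_trans _ _ ((`|M| + 1) * `|x - y|)).
  by rewrite ler_wpM2r// (le_trans (ler_norm _))// lerDl.
rewrite mulrC -ltr_pdivlMr//; near: y.
by have := nbhsx_ballx x _ (divr_gt0 e0 M0); rewrite -ball_normE.
Unshelve. all: by end_near. Qed.

(** Birkhoff's transitivity argument: the points whose orbit enters the ball of radius 1/(m+1) about
    the k-th term of a dense sequence form an open dense set, and by Baire's theorem some point lies
    in all of these sets. *)
Lemma transitive_hypercyclic (E : completeNormedModType R) (A : E -> E) :
  separable E -> continuous A ->
  (forall x y e, 0 < e -> exists z n,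
    [/\ (0 < n)%N, `|z - x| < e & `|iter n A z - y| < e]) ->
  hypercyclic A.
Proof.
move=> [D cD dD] cA trA.
have cAn n : continuous (iter n A).
  elim: n => [|n ih] x; first exact: cvg_id.
  by apply: continuous_comp; [exact: ih|exact: cA].
pose U y r := \bigcup_(n in [set n | (0 < n)%N]) (iter n A) @^-1` ball y r.
have UP y r : 0 < r -> open (U y r) /\ dense (U y r).
  move=> r0; split.
    apply: bigcup_open => n _; apply: open_comp; last exact: ball_open.
    by move=> x _; exact: cAn.
  apply/denseP => x e e0.
  have [|z [n [n0 zx zy]]] := trA x y (Num.min e r); first by rewrite lt_min e0.
  move: zx zy; rewrite !lt_min => /andP[zx _] /andP[_ zy].
  by exists z => //; exists n => //=; rewrite -ball_normE /= distrC.
have [D0|[s]] := pfcard_geP cD.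
  have [|x []] := dD setT _ openT; first by exists 0.
  by rewrite D0.
(* Pairs (k, m) are coded by natural numbers; a number coding no pair contributes the whole
   space. *)
pose F i := if unpickle i is Some (k, m) then U (s k) (m.+1%:R^-1) else setT.
have : dense (\bigcap_i F i).
  apply: Baire => i; rewrite /F; case: unpickle => [[k m]|].
    by apply: UP; rewrite invr_gt0.
  by split; [exact: openT|move=> O O0 _; rewrite setIT].
move=> /(_ setT _ openT)[|x [_ xF]]; first by exists 0.
exists x; apply/denseP => y e e0.
have e20 : 0 < e / 2 by rewrite divr_gt0.
have [z Dz zy] := (denseP D).1 dD y (e / 2) e20.
have [k _ kz] := @surj _ _ _ _ s z Dz.
pose m := Num.truncn (e / 2)^-1.
have me : m.+1%:R^-1 < e / 2.
  by rewrite -[e / 2]invrK ltf_pV2 ?posrE ?invr_gt0// truncnS_gt.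
have := xF (pickle (k, m)) I; rewrite /F pickleK => -[n /= n0].
rewrite kz -ball_normE /= => zx.
exists (iter n A x); first by exists n.
rewrite (splitr e) (le_lt_trans (ler_distD z _ _))// ltrD//.
by rewrite distrC (lt_trans zx).
Qed.

End dynamics_theory.

(** * Completeness of L^p *)

(** For a > 0 the power is differentiable at a, hence continuous. At a = 0 the estimate is direct: w
    n < e^(1/p) gives (w n)^p < e. *)
Lemma powR_cvg (R : realType) (p : R) (w : R ^nat) (a : R) : 0 < p ->
  (forall n, 0 <= w n) -> w @ \oo --> a -> w n `^ p @[n --> \oo] --> a `^ p.
Proof.
move=> p0 w0 wa.
have : 0 <= a.
  by rewrite -(cvg_lim _ wa)//; apply: limr_ge; [exact: cvgP wa|exact: nearW].
rewrite le_eqVlt => /predU1P[a0|a0]; last first.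
  apply: (@continuous_cvg _ _ _ _ _ w (fun x => x `^ p)) wa.
  apply/differentiable_continuous/derivable1_diffP.
  by apply: derivable_powR; rewrite in_itv/= a0.
rewrite -a0 powR0 ?gt_eqF//; apply/cvgrPdist_lt => e e0.
move: wa; rewrite -a0 => /cvgrPdist_lt/(_ (e `^ p^-1)).
rewrite powR_gt0// => /(_ isT); apply: filterS => n.
rewrite !sub0r !normrN !ger0_norm ?powR_ge0// => wn.
rewrite -[ltRHS](@powRr1 _ e) ?ltW// -(@mulVf _ p) ?gt_eqF// powRrM.
by apply: gt0_ltr_powR; rewrite ?nnegrE ?powR_ge0.
Qed.

Lemma limn_einf_le (R : realType) (w : (\bar R)^nat) (k : nat) (c : \bar R) :
  (forall m, (k <= m)%N -> (w m <= c)%E) -> (limn_einf w <= c)%E.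
Proof.
move=> wc; rewrite limn_einf_lim; apply: lime_le; first exact: is_cvg_einfs.
apply: nearW => n; apply: le_trans (wc (maxn n k) (leq_maxr _ _)).
by apply: ereal_inf_lbound; exists (maxn n k) => //=; exact: leq_maxl.
Qed.

(** The sequence is its first term plus a telescoping series dominated by a geometric one. *)
Lemma geometric_increments_cvg (R : realType) (w : R ^nat) (C : R) :
  (forall k, `|w k.+1 - w k| <= C * 2^-1 ^+ k) -> cvgn w.
Proof.
move=> wC; suff : cvgn (series (telescope w)).
  move=> cw; rewrite (_ : w = cst (w 0%N) \+ series (telescope w)).
    by apply: is_cvgD => //; exact: is_cvg_cst.
  by apply/funext => n; exact: eq_sum_telescope.
apply: normed_cvg; apply: (@series_le_cvg _ _ (geometric C 2^-1)).
- by move=> n; exact: normr_ge0.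
- by move=> n; exact: le_trans (wC n).
- exact: wC.
- by apply: is_cvg_geometric_series; rewrite ger0_norm// invf_lt1// ltr1n.
Qed.

(** The upper limit in the extended reals is measurable everywhere and equals the limit wherever
    that exists; [fine] replaces infinite values by 0. *)
Lemma measurable_limit_exists (R : realType) d (T : measurableType d)
    (u : nat -> T -> R) : (forall k, measurable_fun setT (u k)) ->
  exists2 v : T -> R, measurable_fun setT v &
    forall x, cvgn (u ^~ x) -> u ^~ x @ \oo --> v x.
Proof.
move=> mu_; exists (fun x => fine (limn_esup (fun k => (u k x)%:E))).
  apply: measurableT_comp => //; apply: measurable_fun_limn_esup => k.
  exact/measurable_EFinP.
move=> x cux; have /cvg_limn_einf_sup[_ ->] :
    (u k x)%:E @[k --> \oo] --> (limn (u ^~ x))%:E.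
  by apply: cvg_EFin; [exact: nearW|exact: cux].
exact: cux.
Qed.

(** * Moduli and pointwise limits of scalar functions *)

Lemma modulusN (R : realType) (K : scalars) (x : Defs.scalar R K) :
  modulus (- x) = modulus x.
Proof. by rewrite -scaleN1r modulusZ normrN normr1 mul1r. Qed.

Lemma modulus_dist (R : realType) (K : scalars) (x y : Defs.scalar R K) :
  `|modulus x - modulus y| <= modulus (x - y).
Proof.
have le_dist (a b : Defs.scalar R K) : modulus a - modulus b <= modulus (a - b).
  by rewrite lerBlDr (le_trans _ (modulusD _ _))// subrK.
by rewrite ler_norml le_dist andbT lerNl opprB -(modulusN (x - y)) opprB.
Qed.

Lemma smeasurableB (R : realType) (K : scalars) d (T : measurableType d)
    (u v : T -> Defs.scalar R K) :
  smeasurable u -> smeasurable v -> smeasurable (u - v).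
Proof.
move=> mu mv; rewrite -scaleN1r; apply: smeasurableD => //.
exact: smeasurableZ.
Qed.

Section complex_modulus.
Context (R : realType).
Implicit Type z : Defs.scalar R Complexes.

Lemma modulusE z :
  modulus z = Num.sqrt (complex.Re z ^+ 2 + complex.Im z ^+ 2).
Proof. by case: z. Qed.

Lemma Re_le_modulus z : `|complex.Re z| <= modulus z.
Proof.
by rewrite modulusE -sqrtr_sqr ler_wsqrtr// lerDl sqr_ge0.
Qed.

Lemma Im_le_modulus z : `|complex.Im z| <= modulus z.
Proof.
by rewrite modulusE -sqrtr_sqr ler_wsqrtr// lerDr sqr_ge0.
Qed.

Lemma modulus_le_Re_Im z : modulus z <= `|complex.Re z| + `|complex.Im z|.
Proof.
rewrite modulusE -[leRHS]ger0_norm ?addr_ge0// -sqrtr_sqr ler_wsqrtr//.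
by rewrite sqrrD !real_normK ?num_real// addrAC lerDl mulrn_wge0 ?mulr_ge0.
Qed.

End complex_modulus.

(** A single measurable v is fixed before the point x, so it is the pointwise limit wherever the
    increments decay geometrically. Complex limits are taken in real and imaginary parts. *)
Lemma smeasurable_limit_exists (R : realType) (K : scalars) d
    (T : measurableType d) (u : nat -> T -> Defs.scalar R K) :
    (forall k, smeasurable (u k)) ->
  exists2 v : T -> Defs.scalar R K, smeasurable v &
    forall x C, (forall k, modulus (u k.+1 x - u k x) <= C * 2^-1 ^+ k) ->
      modulus (v x - u k x) @[k --> \oo] --> (0 : R).
Proof.
case: K u => u mu_.
  have [v mv uv] := measurable_limit_exists mu_.
  exists v => // x C uC.
  have ux : u ^~ x @ \oo --> v x.
    by apply: uv; exact: geometric_increments_cvg uC.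
  rewrite -(@normr0 _ R) -[X in `|X|](subrr (v x)).
  by apply: cvg_norm; apply: cvgB => //; exact: cvg_cst.
have [vr mvr uvr] := measurable_limit_exists (fun k => (mu_ k).1).
have [vi mvi uvi] := measurable_limit_exists (fun k => (mu_ k).2).
exists (fun x => complex.Complex (vr x) (vi x) : Defs.scalar R Complexes) => //.
move=> x C uC.
have ReB (z z' : Defs.scalar R Complexes) :
  complex.Re (z - z') = complex.Re z - complex.Re z' by case: z z' => ? ? [].
have ImB (z z' : Defs.scalar R Complexes) :
  complex.Im (z - z') = complex.Im z - complex.Im z' by case: z z' => ? ? [].
have ur : complex.Re (u k x) @[k --> \oo] --> vr x.
  apply: uvr; apply: (@geometric_increments_cvg _ _ C) => k; rewrite -ReB.
  exact: le_trans (Re_le_modulus _) (uC k).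
have ui : complex.Im (u k x) @[k --> \oo] --> vi x.
  apply: uvi; apply: (@geometric_increments_cvg _ _ C) => k; rewrite -ImB.
  exact: le_trans (Im_le_modulus _) (uC k).
apply: (@squeeze_cvgr _ _ _ _ (cst 0)
  (fun k => `|vr x - complex.Re (u k x)| + `|vi x - complex.Im (u k x)|)).
- apply: nearW => k; rewrite modulus_ge0/=.
  by apply: le_trans (modulus_le_Re_Im _) _; rewrite ReB ImB.
- exact: cvg_cst.
- rewrite -[X in _ --> X](addr0 0) -(@normr0 _ R).
  rewrite -{1}(subrr (vr x)) -(subrr (vi x)).
  by apply: cvgD; apply: cvg_norm; apply: cvgB => //; exact: cvg_cst.
Qed.

(** * Norm limits obtained from pointwise limits *)

Section Lp_complete.
Context (R : realType) (K : scalars) d (T : measurableType d).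
Context (mu : {measure set T -> \bar R}) (p : R) (p1 : 1 <= p).
Implicit Types u v : T -> Defs.scalar R K.

Let p0 : 0 < p. Proof. exact: lt_le_trans p1. Qed.

Lemma integral_modulus_powR u :
  (\int[mu]_x (modulus (u x) `^ p)%:E = pnorm mu p u `^ p)%E.
Proof.
rewrite pnormE -poweRrM mulVf ?gt_eqF// poweRe1//.
by apply: integral_ge0 => x _; rewrite lee_fin powR_ge0.
Qed.

Lemma pnorm_leP u (e : R) : 0 <= e ->
  (pnorm mu p u <= e%:E)%E =
  (\int[mu]_x (modulus (u x) `^ p)%:E <= (e `^ p)%:E)%E.
Proof.
move=> e0; have I0 : (0 <= \int[mu]_x (modulus (u x) `^ p)%:E)%E.
  by apply: integral_ge0 => x _; rewrite lee_fin powR_ge0.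
apply/idP/idP => ue.
  rewrite integral_modulus_powR -poweR_EFin.
  by apply: gt0_ler_poweR; rewrite ?in_itv/= ?leey ?andbT ?pnorm_ge0// ltW.
rewrite pnormE -[e]powRr1// -(@mulfV _ p) ?gt_eqF// powRrM -poweR_EFin.
apply: gt0_ler_poweR; rewrite ?in_itv/= ?leey ?andbT//.
- by rewrite invr_ge0 ltW.
- by rewrite lee_fin powR_ge0.
Qed.

Lemma pfun_mem_dist (u : pfun K mu p1) v : smeasurable v ->
  (pnorm mu p (v - (u : T -> _))%R < +oo)%E -> v \in pintegrable mu p.
Proof.
move=> mv vu; rewrite inE; split=> //; rewrite -(subrK (u : T -> _) v).
have mvu : smeasurable (v - (u : T -> _)).
  by apply: smeasurableB => //; exact: pfun_meas.
apply: le_lt_trans (pnormD mu p1 mvu (pfun_meas u)) _.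
by rewrite lte_add_pinfty// ltey_eq pfun_fin_num.
Qed.

(* The series of the |2^k (u_{k+1} - u_k)|^p has a finite integral, so it is
   finite almost everywhere and bounds each of its terms. *)
Lemma geometric_pnorm_ae_increments (u : nat -> pfun K mu p1) :
  (forall k, (pnorm mu p (u k.+1 - u k)%R <= (4^-1 ^+ k)%:E)%E) ->
  \forall x \ae mu, exists C, forall k,
    modulus (u k.+1 x - u k x) <= C * 2^-1 ^+ k.
Proof.
(* The decay 4^-k is split in two: multiplied by 2^k the increments still have norm at most 2^-k,
   and a pointwise bound on the products leaves the factor 2^-k for the increments. *)
move=> uk; pose D k : T -> Defs.scalar R K := 2 ^+ k *: (u k.+1 - u k : T -> _).
have mD k : smeasurable (D k).
  apply: smeasurableZ; exact: (pfun_meas (u k.+1 - u k)).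
have D0 k x : (0 <= (modulus (D k x) `^ p)%:E)%E by rewrite lee_fin powR_ge0.
have mDp k : measurable_fun setT (fun x => (modulus (D k x) `^ p)%:E).
  exact: measurable_modulus_powR.
have Dk k : (\int[mu]_x (modulus (D k x) `^ p)%:E <= (2^-1 ^+ k)%:E)%E.
  have Dn : (pnorm mu p (D k) <= (2^-1 ^+ k)%:E)%E.
    rewrite (pnormZ mu p1 _ (pfun_meas (u k.+1 - u k))).
    rewrite ger0_norm ?exprn_ge0//.
    apply: (@le_trans _ _ ((2 ^+ k)%:E * (4^-1 ^+ k)%:E)%E).
      by apply: lee_wpmul2l; rewrite ?lee_fin ?exprn_ge0//; exact: uk.
    rewrite -EFinM -exprMn lee_fin.
    by rewrite (_ : 2 * 4^-1 = 2^-1 :> R)//; field.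
  rewrite pnorm_leP ?exprn_ge0 ?invr_ge0// in Dn.
  (* Since 0 < 2^-k <= 1 and p >= 1, the p-th power of 2^-k is at most 2^-k. *)
  apply: le_trans Dn _; rewrite lee_fin ge1r_powR//.
  by rewrite exprn_gt0 ?invr_gt0//= exprn_ile1 ?invr_ge0// invf_le1// ler1n.
pose h x := (\sum_(k <oo) (modulus (D k x) `^ p)%:E)%E.
have h0 x : (0 <= h x)%E by apply: nneseries_ge0.
have ih : mu.-integrable setT h.
  apply/integrableP; split; first exact: ge0_emeasurable_sum.
  under eq_integral do rewrite gee0_abs//.
  rewrite integral_nneseries//.
  apply: (@le_lt_trans _ _ (\sum_(k <oo) (2 / (2 ^ (k + 1))%:R)%:E)%E).
    apply: lee_nneseries => [k _ _|k _]; first exact: integral_ge0.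
    apply: le_trans (Dk k) _; rewrite lee_fin addn1 expnS natrM natrX.
    by rewrite invfM mulrA divff// mul1r exprVn.
  by have /cvg_lim -> // := @cvg_geometric_eseries_half R 2 0; rewrite ltry.
apply: filterS (integrable_ae measurableT ih) => x /(_ I) hx.
exists (fine (h x) `^ p^-1) => k.
have : ((modulus (D k x) `^ p)%:E <= (fine (h x))%:E)%E.
  rewrite fineK//; apply: le_trans (nneseries_lim_ge k.+1 _); last first.
    by move=> *; exact: D0.
  by rewrite big_nat_recr//= leeDr// sume_ge0.
rewrite lee_fin => Dh.
have : modulus (D k x) <= fine (h x) `^ p^-1.
  rewrite -[leLHS]powRr1 ?modulus_ge0// -(@mulfV _ p) ?gt_eqF// powRrM.
  by rewrite ge0_ler_powR ?nnegrE ?powR_ge0 ?invr_ge0 ?fine_ge0// ltW.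
rewrite -[D k x]/(2 ^+ k *: (u k.+1 x - u k x)) modulusZ.
by rewrite ger0_norm ?exprn_ge0// exprVn mulrC -ler_pdivlMr ?exprn_gt0.
Qed.

(** The limit is found pointwise almost everywhere; Fatou's lemma for |u_m - u_k|^p as m grows gives
    the norm bound, and the bound for k = 0 puts v in L^p. *)
Lemma geometric_pnorm_limit (u : nat -> pfun K mu p1) :
  (forall k m, (k <= m)%N ->
    (pnorm mu p (u m - u k)%R <= (4^-1 ^+ k)%:E)%E) ->
  exists v : pfun K mu p1,
    forall k, (pnorm mu p (v - u k)%R <= (4^-1 ^+ k)%:E)%E.
Proof.
move=> uC.
have uae := geometric_pnorm_ae_increments (fun k => uC k k.+1 (leqnSn k)).
have [v mv uv] := smeasurable_limit_exists (fun k => pfun_meas (u k)).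
suff vle k : (pnorm mu p (v - (u k : T -> _))%R <= (4^-1 ^+ k)%:E)%E.
  have vL : v \in pintegrable mu p.
    apply: (@pfun_mem_dist (u 0%N)) => //.
    by rewrite (le_lt_trans (vle 0%N))// ltry.
  by exists (Defs.Pfun p1 vL).
have e0 : 0 <= 4^-1 ^+ k :> R by rewrite exprn_ge0// invr_ge0.
rewrite pnorm_leP//.
pose g m x : \bar R := (modulus (u m x - u k x) `^ p)%:E.
have mg m : measurable_fun setT (g m).
  by apply: measurable_modulus_powR; exact: (pfun_meas (u m - u k)).
have g0 m x : (0 <= g m x)%E by rewrite lee_fin powR_ge0.
have mlg : measurable_fun setT (fun x => limn_einf (g ^~ x)).
  rewrite /limn_einf; apply: measurableT_comp => //.
  by apply: measurable_fun_limn_esup => m; exact: measurableT_comp.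
have -> : (\int[mu]_x (modulus ((v - (u k : T -> _))%R x) `^ p)%:E =
    \int[mu]_x limn_einf (g ^~ x))%E.
  apply: ge0_ae_eq_integral => //.
  - apply: measurable_modulus_powR; apply: smeasurableB => //.
    exact: pfun_meas.
  - by move=> x _; rewrite lee_fin powR_ge0.
  - move=> x _; rewrite limn_einf_lim.
    apply: lime_ge; first exact: is_cvg_einfs.
    by apply: nearW => n; apply: le_ereal_inf_tmp => _ [m _ <-].
  (* Off a null set u_m(x) tends to v(x), so the lower limit is the integrand formed with v. *)
  - apply: filterS uae => x [C uC' _]; apply/esym.
    suff /cvg_limn_einf_sup[-> _] :
        g n x @[n --> \oo] --> (modulus (v x - u k x) `^ p)%:E by [].
    apply: cvg_EFin; first exact: nearW.
    apply: powR_cvg => // [n|]; first exact: modulus_ge0.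
    have vu := uv x C uC'.
    apply/cvgrPdist_le => e e0'; move/cvgrPdist_le : vu => /(_ e e0').
    apply: filterS => n; rewrite sub0r normrN ger0_norm ?modulus_ge0//.
    apply: le_trans; rewrite (le_trans (modulus_dist _ _))//.
    by rewrite opprB addrA subrK.
apply: le_trans (fatou mu measurableT mg _) _ => //.
apply: (@limn_einf_le _ _ k) => m km.
by rewrite -pnorm_leP//; exact: uC.
Qed.

End Lp_complete.

(** * L^p as a space of classes: completeness and continuity of the operator *)

Section Lp_norm.
Context (R : realType) (K : scalars) d (T : measurableType d).
Context (mu : {measure set T -> \bar R}) (p : R) (p1 : 1 <= p).
Implicit Types u v : pfun K mu p1.

Lemma norm_piLp_le u (e : R) :
  (`|\pi_(Lp K mu p1) u| <= e) = (pnorm mu p u <= e%:E)%E.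
Proof.
by rewrite -[`|_|]/(normLp _) normLpE -lee_fin fineK// pfun_fin_num.
Qed.

Lemma piLpB u v :
  \pi_(Lp K mu p1) (u - v) = \pi_(Lp K mu p1) u - \pi_(Lp K mu p1) v.
Proof. by apply/eqP; rewrite eq_sym subr_eq -piLpD subrK. Qed.

(** A Cauchy filter contains a ball of radius 4^-k / 2 for each k. Points x_k common to the balls up
    to the k-th satisfy |x_m - x_k| <= 4^-k for k <= m, and their limit is the limit of the filter
    because the k-th ball lies within 4^-k of x_k. *)
Lemma Lp_cauchy_cvg (F : set_system (Lp K mu p1)) :
  ProperFilter F -> cauchy F -> cvg F.
Proof.
move=> FF /cauchyP cF; pose r k : R := 4^-1 ^+ k / 2.
have r0 k : 0 < r k by rewrite divr_gt0// exprn_gt0// invr_gt0.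
pose c k := sval (cid (cF _ (r0 k))).
have cP k : F (ball (c k) (r k)) := svalP (cid (cF _ (r0 k))).
have FB k : F [set x | forall i, (i <= k)%N -> ball (c i) (r i) x].
  elim: k => [|k ih]; first by apply: filterS (cP 0%N) => x cx i; case: i.
  apply: filterS2 ih (cP k.+1) => x ih cx i.
  by rewrite leq_eqVlt => /predU1P[->|]//; exact: ih.
pose x k := sval (cid (@filter_ex _ F FF _ (FB k))).
have xP k i : (i <= k)%N -> ball (c i) (r i) (x k) :=
  svalP (cid (@filter_ex _ F FF _ (FB k))) i.
have dist_ball k y z : ball (c k) (r k) y -> ball (c k) (r k) z ->
    `|y - z| <= 4^-1 ^+ k.
  rewrite -!ball_normE/= distrC => cy cz.
  rewrite (le_trans (ler_distD (c k) _ _))// [leRHS]splitr.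
  by rewrite lerD// ltW.
have [|v vx] := @geometric_pnorm_limit _ _ _ _ _ _ p1 (fun k => repr (x k)).
  move=> k m km; rewrite -norm_piLp_le piLpB !reprK.
  by apply: (dist_ball k); exact: xP.
apply/cvg_ex; exists (\pi_(Lp K mu p1) v); apply/cvg_ballP => e e0.
have e20 : 0 < e / 2 by rewrite divr_gt0.
have [k ke] : exists k, 4^-1 ^+ k < e / 2.
  have q1 : `|4^-1| < 1 :> R by rewrite ger0_norm// invf_lt1// ltr1n.
  have /cvgrPdist_lt/(_ (e / 2) e20) := cvg_expr q1.
  move=> [k _ /(_ k (leqnn k))].
  by rewrite sub0r normrN ger0_norm ?exprn_ge0 ?invr_ge0//; exists k.
apply: filterS (cP k) => y cy; rewrite -ball_normE /=.
rewrite (le_lt_trans (ler_distD (x k) _ _))// [ltRHS]splitr ltrD//.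
  apply: le_lt_trans ke; rewrite -[x k]reprK -piLpB norm_piLp_le; exact: vx.
by apply: le_lt_trans ke; apply: (dist_ball k) => //; exact: xP.
Qed.

HB.instance Definition _ := Uniform_isComplete.Build (Lp K mu p1) Lp_cauchy_cvg.

Lemma comp_op_continuous (f : T -> T) (hf : bounded_preimage mu f) :
  continuous (comp_op K p1 hf).
Proof.
have [M TM] := comp_op_bounded K p1 hf.
apply: (bounded_additive_continuous _ TM) => y x.
by rewrite addrC -scaleN1r comp_op_is_linear scaleN1r addrC.
Qed.

End Lp_norm.

(** * Composition operators *)

Section iterates.
Context (R : realType) d (T : measurableType d).
Context (mu : {measure set T -> \bar R}) (f : T -> T).
Hypothesis hf : bounded_preimage mu f.

Lemma bounded_preimage_iter n : bounded_preimage mu (iter n f).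
Proof.
elim: n => [|n [mfn [c c0 cB]]].
  by split; [exact: measurable_id|exists 1 => // B mB; rewrite mul1e].
have [mf [b b0 bB]] := hf; split; first exact: measurableT_comp.
exists (c * b) => [|B mB]; first exact: mulr_gt0.
have mfB : measurable (f @^-1` B).
  by rewrite -[X in measurable X]setTI; exact: mf.
rewrite (le_trans (cB _ mfB))// EFinM -muleA lee_wpmul2l ?bB//.
by rewrite lee_fin ltW.
Qed.

Context (K : scalars) (p : R) (p1 : 1 <= p).

Lemma iter_comp_op n (u : pfun K mu p1) :
  iter n (comp_op K p1 hf) (\pi_(Lp K mu p1) u) =
  \pi_(Lp K mu p1) (comp_fun (bounded_preimage_iter n) u).
Proof.
elim: n => [|n ih].
  by apply/Lp_eqP; exact: nearW.
rewrite iterS ih comp_opE; apply/Lp_eqP; apply: nearW => x.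
by rewrite /comp_fun /= -iterSr.
Qed.

End iterates.

(** * Truncation of scalar functions to a set *)

Definition restrict_scalar (R : realType) (K : scalars) d (T : measurableType d)
  (A : set T) (u : T -> Defs.scalar R K) : T -> Defs.scalar R K :=
  fun x => (\1_A x : R) *: u x.

Section truncation.
Context (R : realType) (K : scalars) d (T : measurableType d).
Implicit Types (u : T -> Defs.scalar R K) (A : set T).

Lemma restrict_scalar_in A u x : A x -> restrict_scalar A u x = u x.
Proof. by move=> Ax; rewrite /restrict_scalar indicE mem_set// scale1r. Qed.

Lemma restrict_scalar_out A u x : ~ A x -> restrict_scalar A u x = 0.
Proof. by move=> Ax; rewrite /restrict_scalar indicE memNset// scale0r. Qed.

Lemma smeasurable_restrict_scalar A u :
  measurable A -> smeasurable u -> smeasurable (restrict_scalar A u).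
Proof.
move=> mA; have m1 : measurable_fun setT (\1_A : T -> R) by [].
case: K u => u /=; first by move=> mu'; exact: measurable_funM.
move=> [ru iu]; split.
- rewrite (_ : (fun _ => _) = (\1_A : T -> R) \* (fun t => complex.Re (u t))).
    exact: measurable_funM.
  by apply/funext => t /=; rewrite /restrict_scalar; case: (u t).
- rewrite (_ : (fun _ => _) = (\1_A : T -> R) \* (fun t => complex.Im (u t))).
    exact: measurable_funM.
  by apply/funext => t /=; rewrite /restrict_scalar; case: (u t).
Qed.

Lemma modulus_restrict_scalar_le A u x :
  modulus (restrict_scalar A u x) <= modulus (u x).
Proof.
have [Ax|Ax] := pselect (A x); first by rewrite restrict_scalar_in.
by rewrite restrict_scalar_out// modulus0 modulus_ge0.
Qed.

(** Supplies the value 1 of indicator functions for both scalar fields at once. *)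
Lemma exists_unit_scalar : exists s : Defs.scalar R K, modulus s = 1.
Proof.
case: K; first by exists (1 : R); rewrite /= normr1.
by exists (complex.Complex 1 0); rewrite modulusE /= expr1n expr0n addr0 sqrtr1.
Qed.

Lemma smeasurable_cst (s : Defs.scalar R K) : smeasurable (fun _ : T => s).
Proof. by case: K s => s /=; [|split]; exact: measurable_cst. Qed.

Lemma measurable_modulus_ge u (a : R) :
  smeasurable u -> measurable [set x | a <= modulus (u x)].
Proof.
move=> mu'; have := measurable_modulus mu'.
move=> /(_ measurableT `[a, +oo[%classic (measurable_itv _)); rewrite setTI.
by congr measurable; apply/seteqP; split => x /=; rewrite in_itv/= andbT.
Qed.

Lemma measurable_modulus_le u (a : R) :
  smeasurable u -> measurable [set x | modulus (u x) <= a].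
Proof.
move=> mu'; have := measurable_modulus mu'.
move=> /(_ measurableT `]-oo, a]%classic (measurable_itv _)); rewrite setTI.
by congr measurable; apply/seteqP; split => x /=; rewrite in_itv.
Qed.

End truncation.

(** * Estimates of norms and of level sets *)

Section pnorm_estimates.
Context (R : realType) (K : scalars) d (T : measurableType d).
Context (mu : {measure set T -> \bar R}) (p : R) (p1 : 1 <= p).
Implicit Types (u v : T -> Defs.scalar R K) (A : set T).

Let p0 : 0 < p. Proof. exact: lt_le_trans p1. Qed.

Lemma pintegrable_le u v : smeasurable u -> v \in pintegrable mu p ->
  (forall x, modulus (u x) <= modulus (v x)) -> u \in pintegrable mu p.
Proof.
move=> mu'; rewrite !inE => -[mv vfin] uv; split=> //.
apply: le_lt_trans vfin; rewrite !pnormE.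
apply: gt0_ler_poweR; rewrite ?in_itv/= ?leey ?andbT ?invr_ge0 ?(ltW p0)//.
- by apply: integral_ge0 => x _; rewrite lee_fin powR_ge0.
- by apply: integral_ge0 => x _; rewrite lee_fin powR_ge0.
apply: ge0_le_integral => //.
- by move=> x _; rewrite lee_fin powR_ge0.
- exact: measurable_modulus_powR.
- exact: measurable_modulus_powR.
- by move=> x _; rewrite lee_fin ge0_ler_powR ?nnegrE ?modulus_ge0// ltW.
Qed.

Lemma restrict_scalar_pintegrable A (u : pfun K mu p1) :
  measurable A -> restrict_scalar A (u : T -> _) \in pintegrable mu p.
Proof.
move=> mA; apply: (pintegrable_le _ (pfun_in u)).
  by apply: smeasurable_restrict_scalar => //; exact: pfun_meas.
by move=> x; exact: modulus_restrict_scalar_le.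
Qed.

Lemma integral_bounded_support A u (M : R) : measurable A -> smeasurable u ->
  0 <= M -> (forall x, A x -> modulus (u x) <= M) ->
  (forall x, ~ A x -> u x = 0) ->
  (\int[mu]_x (modulus (u x) `^ p)%:E <= (M `^ p)%:E * mu A)%E.
Proof.
move=> mA mu' M0 uM u0.
apply: (@le_trans _ _ (\int[mu]_x ((M `^ p)%:E * (\1_A x)%:E))%E).
  apply: ge0_le_integral => //.
  - by move=> x _; rewrite lee_fin powR_ge0.
  - exact: measurable_modulus_powR.
  - by apply/measurable_EFinP; apply: measurable_funM.
  move=> x _; have [Ax|Ax] := pselect (A x).
    rewrite indicE mem_set// mule1 lee_fin.
    by rewrite ge0_ler_powR ?nnegrE ?modulus_ge0 ?uM// ltW.
  by rewrite u0// modulus0 powR0 ?gt_eqF// mule_ge0// lee_fin powR_ge0.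
rewrite ge0_integralZl ?lee_fin ?powR_ge0//.
- by rewrite integral_indic// setIT.
- exact/measurable_EFinP.
Qed.

(** The p-th power of the norm is at most M^p times the measure of A, so r can be chosen from M and
    e alone, uniformly in A and u. *)
Lemma pnorm_small_support (M e : R) : 0 <= M -> 0 < e ->
  exists2 r, 0 < r & forall A u, measurable A -> smeasurable u ->
    (mu A <= r%:E)%E -> (forall x, A x -> modulus (u x) <= M) ->
    (forall x, ~ A x -> u x = 0) -> (pnorm mu p u <= e%:E)%E.
Proof.
move=> M0 e0; have M1 : 0 < M `^ p + 1 by rewrite ltr_wpDl ?powR_ge0.
(* The summand 1 keeps the denominator positive when M = 0. *)
exists (e `^ p / (M `^ p + 1)); first by rewrite divr_gt0 ?powR_gt0.
move=> A u mA mu' Ar uM u0; rewrite pnorm_leP ?(ltW e0)//.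
apply: le_trans (integral_bounded_support mA mu' M0 uM u0) _.
apply: le_trans (lee_wpmul2l _ Ar) _; first by rewrite lee_fin powR_ge0.
rewrite -EFinM lee_fin mulrCA ler_piMr ?powR_ge0//.
by rewrite ler_pdivrMr// mul1r lerDl.
Qed.

(** Chebyshev's inequality: 2^-p times this measure is at most the p-th power of the norm, and r =
    e^(1/p) / 2 has p-th power 2^-p e. *)
Lemma measure_modulus_ge_half_small (e : R) : 0 < e ->
  exists2 r, 0 < r & forall u, smeasurable u -> (pnorm mu p u <= r%:E)%E ->
    (mu [set x | (2^-1 <= modulus (u x))%R] <= e%:E)%E.
Proof.
move=> e0; exists (e `^ p^-1 / 2); first by rewrite divr_gt0 ?powR_gt0.
move=> u mu'; rewrite pnorm_leP ?divr_ge0 ?powR_ge0// => ur.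
have h0 : 0 < 2^-1 `^ p :> R by rewrite powR_gt0 ?invr_gt0.
rewrite powRM ?powR_ge0 ?invr_ge0// -powRrM in ur.
rewrite mulVf ?gt_eqF// powRr1 ?(ltW e0)// in ur.
have := @le_integral_abse _ _ _ mu setT measurableT
  (fun x => (modulus (u x) `^ p)%:E) _ (measurable_modulus_powR p mu') h0.
rewrite setTI.
rewrite (_ : [set x | _] = [set x | (2^-1 <= modulus (u x))%R]); last first.
  apply/seteqP; split => x /=; rewrite lee_fin ger0_norm ?powR_ge0//.
    apply: contraTT; rewrite -!ltNge => ux.
    by rewrite gt0_ltr_powR ?nnegrE ?modulus_ge0.
  by move=> ux; rewrite ge0_ler_powR ?nnegrE ?modulus_ge0// ltW.
move=> cheb; rewrite -(@lee_pmul2l _ (2^-1 `^ p)%:E) ?lte_fin//.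
apply: le_trans cheb _; rewrite -EFinM [in leRHS]mulrC; apply: le_trans ur.
rewrite le_eqVlt; apply/orP; left; apply/eqP; apply: eq_integral => x _.
by rewrite gee0_abs// lee_fin powR_ge0.
Qed.

(** Dominated convergence with dominating function |u|^p: each x lies in [A n] for all large n, and
    from then on the integrand vanishes at x. *)
Lemma pnorm_restrict_scalar_cvg (u : pfun K mu p1) (A : (set T)^nat) (e : R) :
  (forall n, measurable (A n)) ->
  (forall x, exists N, forall n, (N <= n)%N -> A n x) ->
  0 < e ->
  exists N, forall n, (N <= n)%N ->
    (pnorm mu p ((u : T -> _) - restrict_scalar (A n) u)%R <= e%:E)%E.
Proof.
move=> mA Ax e0.
pose g n x := (modulus (u x - restrict_scalar (A n) (u : T -> _) x) `^ p)%:E.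
have mB n : smeasurable ((u : T -> _) - restrict_scalar (A n) u).
  apply: smeasurableB; first exact: pfun_meas.
  by apply: smeasurable_restrict_scalar => //; exact: pfun_meas.
have mg n : measurable_fun setT (g n) by exact: measurable_modulus_powR (mB n).
have iu : mu.-integrable setT (fun x => (modulus (u x) `^ p)%:E).
  apply/integrableP; split; first exact: measurable_modulus_powR (pfun_meas u).
  rewrite (eq_integral (fun x => (modulus (u x) `^ p)%:E)); last first.
    by move=> x _; rewrite gee0_abs// lee_fin powR_ge0.
  by rewrite integral_modulus_powR// poweR_lty// ltey_eq pfun_fin_num.
have [|||_ _] := @dominated_convergence _ _ _ mu setT measurableT g (cst 0)%E
  (fun x => (modulus (u x) `^ p)%:E) mg _ _ iu.
- exact: measurable_cst.
- apply: nearW => x _; apply: (cvg_near_cst 0%E) => /=.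
  have [N HN] := Ax x; exists N => // n /HN An.
  by rewrite /g restrict_scalar_in// subrr modulus0 powR0// gt_eqF.
- apply: nearW => x n _; rewrite gee0_abs ?lee_fin ?powR_ge0//.
  rewrite ge0_ler_powR ?nnegrE ?modulus_ge0 ?(ltW p0)//.
  have [An|An] := pselect (A n x).
    by rewrite restrict_scalar_in// subrr modulus0 modulus_ge0.
  by rewrite restrict_scalar_out// subr0.
rewrite integral_cst// mul0e => /fine_cvgP[fin] /cvgrPdist_le.
move=> /(_ (e `^ p) (powR_gt0 _ e0)) => cv.
have [N _ HN] := filterI fin cv.
exists N => n /HN [finn]; rewrite /= sub0r normrN => gn.
rewrite pnorm_leP ?(ltW e0)// -[leLHS]fineK//.
by rewrite lee_fin (le_trans (ler_norm _)).
Qed.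

End pnorm_estimates.

(** * From recurrence to transitivity along an exhaustion *)

Section criterion.
Context (R : realType) (K : scalars) d (T : measurableType d).
Context (mu : {measure set T -> \bar R}) (p : R) (p1 : 1 <= p).
Context (f finv : T -> T).
Hypotheses (fK : cancel f finv) (finvK : cancel finv f).
Hypotheses (hf : bounded_preimage mu f) (hfinv : bounded_preimage mu finv).
Context (E : (set T)^nat).
Hypothesis mE : forall N, measurable (E N).

Let iterK n : cancel (iter n f) (iter n finv).
Proof. by elim: n => // n ih x; rewrite iterSr iterS fK ih. Qed.

Let iterKV n : cancel (iter n finv) (iter n f).
Proof. by elim: n => // n ih x; rewrite iterSr iterS finvK ih. Qed.

(** For mutually inverse f and finv the two preimages are f^n(B) and f^-n(B): up to a small part,
    [E N] is carried forwards and backwards into sets of small measure by one and the same n.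
    Writing them as preimages makes their measurability immediate. *)
Definition escaping_exhaustion := forall N (e : R), 0 < e -> exists n B,
  [/\ (0 < n)%N, measurable B & B `<=` E N] /\
  [/\ (mu (E N `\` B) <= e%:E)%E, (mu (iter n finv @^-1` B) <= e%:E)%E &
    (mu (iter n f @^-1` B) <= e%:E)%E].

Let mpre (g : T -> T) n (B : set T) : bounded_preimage mu g ->
  measurable B -> measurable (iter n g @^-1` B).
Proof.
move=> hg mB; have [mg _] := bounded_preimage_iter hg n.
by rewrite -[X in measurable X]setTI; exact: mg.
Qed.

(* The point close to x and sent close to y is u 1_B + (v 1_B) o f^-n, for
   truncations u of x and v of y. *)
Lemma escaping_exhaustion_transitive :
  {homo E : m n / (m <= n)%N >-> m `<=` n} -> (forall x, exists N, E N x) ->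
  escaping_exhaustion ->
  forall (x y : Lp K mu p1) e, 0 < e -> exists z n,
    [/\ (0 < n)%N, `|z - x| < e & `|iter n (comp_op K p1 hf) z - y| < e].
Proof.
move=> ndE cE esc x y e e0; rewrite -[x]reprK -[y]reprK.
move: (repr x) (repr y) => u v {x y}.
have e40 : 0 < e / 4 by rewrite divr_gt0.
(* Cutting off both the domain and the values at level n gives truncations bounded by n and
   supported in [E n]; every point belongs to these sets from some n on, since E increases and
   covers the space. *)
pose A (w : T -> Defs.scalar R K) n := E n `&` [set x | modulus (w x) <= n%:R].
have mA (w : pfun K mu p1) n : measurable (A w n).
  by apply: measurableI => //; apply: measurable_modulus_le; exact: pfun_meas.
have cA w x : exists N, forall n, (N <= n)%N -> A w n x.
  have [N EN] := cE x; exists (maxn N (Num.bound (modulus (w x)))) => n.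
  rewrite geq_max => /andP[Nn wn]; split; first exact: (ndE _ _ Nn).
  rewrite /= (le_trans (ltW (archi_boundP (modulus_ge0 _))))// ler_nat.
  exact: wn.
have [N1 uN1] := pnorm_restrict_scalar_cvg u (mA u) (cA u) e40.
have [N2 vN2] := pnorm_restrict_scalar_cvg v (mA v) (cA v) e40.
pose N := maxn N1 N2.
have {uN1} uN := uN1 N (leq_maxl _ _).
have {vN2} vN := vN2 N (leq_maxr _ _).
pose trunc (w : pfun K mu p1) : pfun K mu p1 :=
  Defs.Pfun p1 (restrict_scalar_pintegrable w (mA w N)).
have trunc_le w x : modulus (trunc w x) <= N%:R.
  have [[Ex wx]|Ax] := pselect (A w N x).
    by rewrite /= restrict_scalar_in.
  by rewrite /= restrict_scalar_out// modulus0 ler0n.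
have trunc_out w x : ~ E N x -> trunc w x = 0.
  by move=> Ex; rewrite /= restrict_scalar_out// => -[].
(* This r serves three times: for the loss on [E N] minus B and for the two functions shifted by n
   steps. *)
have [r r0 small] := pnorm_small_support K mu p1 (ler0n R N) e40.
have [n [B [[n0 mB BE] [EB finvB fB]]]] := esc N r r0.
pose cut w : pfun K mu p1 :=
  Defs.Pfun p1 (restrict_scalar_pintegrable (trunc w) mB).
have cut_le w x : modulus (cut w x) <= N%:R.
  exact: le_trans (modulus_restrict_scalar_le _ _ _) (trunc_le w x).
have cut_out w x : ~ B x -> cut w x = 0.
  by move=> Bx; rewrite /= restrict_scalar_out.
have cut_trunc w : (pnorm mu p (cut w - trunc w)%R <= (e / 4)%:E)%E.
  apply: (small (E N `\` B)) => //.
  - exact: measurableD.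
  - exact: (pfun_meas (cut w - trunc w)).
  - move=> x [_ Bx]; rewrite -[(cut w - trunc w) x]/(cut w x - trunc w x).
    by rewrite cut_out// sub0r modulusN.
  - move=> x EBx; rewrite -[(cut w - trunc w) x]/(cut w x - trunc w x).
    have [Bx|Bx] := pselect (B x).
      by rewrite /= restrict_scalar_in// subrr.
    by rewrite cut_out// trunc_out ?subrr// => Ex; exact: EBx.
have cut_dist (w : pfun K mu p1) :
    (pnorm mu p (w - trunc w)%R <= (e / 4)%:E)%E ->
    `|\pi_(Lp K mu p1) (cut w) - \pi_(Lp K mu p1) w| <= e / 4 + e / 4.
  move=> wN; rewrite (le_trans (ler_distD (\pi_(Lp K mu p1) (trunc w)) _ _))//.
  rewrite lerD// -piLpB norm_piLp_le ?cut_trunc//.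
  rewrite -norm_piLp_le piLpB distrC -piLpB norm_piLp_le; exact: wN.
(* With u and v truncated, [push] is (v 1_B) o f^-n, supported in f^n(B), and [pull] is (u 1_B) o
   f^n, supported in f^-n(B). *)
pose push := comp_fun (bounded_preimage_iter hfinv n) (cut v).
pose pull := comp_fun (bounded_preimage_iter hf n) (cut u).
have push_le : `|\pi_(Lp K mu p1) push| <= e / 4.
  rewrite norm_piLp_le; apply: (small (iter n finv @^-1` B)) => //.
  - exact: mpre.
  - exact: pfun_meas.
  - by move=> x _; exact: cut_le.
  - by move=> x Bx; exact: cut_out.
have pull_le : `|\pi_(Lp K mu p1) pull| <= e / 4.
  rewrite norm_piLp_le; apply: (small (iter n f @^-1` B)) => //.
  - exact: mpre.
  - exact: pfun_meas.
  - by move=> x _; exact: cut_le.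
  - by move=> x Bx; exact: cut_out.
(* One e / 4 for the shifted function, one for cutting down to B, one for the truncation. *)
have e34 : e / 4 + (e / 4 + e / 4) < e by lra.
exists (\pi_(Lp K mu p1) (push + cut u)), n; split=> //.
  rewrite piLpD -addrA (le_lt_trans (ler_normD _ _))//.
  apply: le_lt_trans e34; apply: lerD => //; exact: cut_dist.
rewrite iter_comp_op.
(* T^n sends [push + cut u] to [pull + cut v], since f^-n o f^n is the identity. *)
have -> : \pi_(Lp K mu p1)
      (comp_fun (bounded_preimage_iter hf n) (push + cut u)) =
    \pi_(Lp K mu p1) (pull + cut v).
  apply/Lp_eqP; apply: nearW => x.
  rewrite -[LHS]/(cut v (iter n finv (iter n f x)) + cut u (iter n f x)) iterK.
  by rewrite addrC.
rewrite piLpD -addrA (le_lt_trans (ler_normD _ _))//.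
apply: le_lt_trans e34; apply: lerD => //; exact: cut_dist.
Qed.

(** Recurrence supplies u such that u and u o f^n are both within r of the indicator of [E N], with
    n so large that f^n moves [E N] off itself; Chebyshev's bound for the two differences then
    controls all three measures. *)
Lemma recurrent_escaping_exhaustion :
  (forall N, (mu (E N) < +oo)%E) ->
  (forall N, exists m, forall n x, (m < n)%N -> E N x -> ~ E N (iter n f x)) ->
  recurrent (comp_op K p1 hf) -> escaping_exhaustion.
Proof.
move=> finE wandering rec N e e0.
have [s s1] := exists_unit_scalar R K.
have one_in : restrict_scalar (E N) (fun _ => s) \in pintegrable mu p.
  have m1 : smeasurable (restrict_scalar (E N) (fun _ => s)).
    by apply: smeasurable_restrict_scalar => //; exact: smeasurable_cst.
  rewrite inE; split=> //; rewrite pnormE poweR_lty//.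
  have := @integral_bounded_support _ _ _ _ mu p p1 _ _ 1 (mE N) m1 ler01.
  move=> /(_ _ _)/le_lt_trans; apply => //.
  - by move=> x Ex; rewrite restrict_scalar_in// s1.
  - by move=> x Ex; rewrite restrict_scalar_out.
  - by rewrite powR1 mul1e.
pose one : pfun K mu p1 := Defs.Pfun p1 one_in.
have oneT x : E N x -> one x = s by move=> Ex; rewrite /= restrict_scalar_in.
have oneF x : ~ E N x -> one x = 0 by move=> Ex; rewrite /= restrict_scalar_out.
have e20 : 0 < e / 2 by rewrite divr_gt0.
(* The bound e / 2 is asked for because two exceptional sets are needed to cover [E N] minus B. *)
have [r r0 cheb] := @measure_modulus_ge_half_small R K _ _ mu p p1 _ e20.
have r20 : 0 < r / 2 by rewrite divr_gt0.
have [x xrec x1] := (denseP _).1 rec (\pi_(Lp K mu p1) one) _ r20.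
have [m mN] := wandering N.
have [n mn xn] := (recurrent_vectorP _ _).1 xrec _ m r20.
have xn1 : `|iter n (comp_op K p1 hf) x - \pi_(Lp K mu p1) one| <= r.
  rewrite (le_trans (ler_distD x _ _))// [leRHS]splitr lerD// ltW//.
move: x1 xn1; rewrite -[x]reprK iter_comp_op -!piLpB.
move: (repr x) => u {x xrec xn}.
have r2r : r / 2 <= r by lra.
move=> /ltW/le_trans/(_ r2r) {r2r}.
set un := comp_fun _ u; rewrite !norm_piLp_le => u1 un1.
pose H (w : T -> Defs.scalar R K) := [set x | 2^-1 <= modulus (w x)].
have mH (w : pfun K mu p1) : measurable (H w).
  by apply: measurable_modulus_ge; exact: pfun_meas.
have muH (w : pfun K mu p1) :
    (pnorm mu p w <= r%:E)%E -> (mu (H w) <= (e / 2)%:E)%E.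
  by move=> wr; apply: cheb => //; exact: pfun_meas.
(* On [E N] the function [one] has modulus 1, so |w| < 1/2 forces |w - one| >= 1/2 there. *)
have half_in (w : pfun K mu p1) x : E N x -> ~ H w x -> H (w - one) x.
  move=> Ex /negP; rewrite -ltNge => wx.
  suff : 2^-1 <= modulus (w x - one x) by [].
  move: wx; rewrite oneT// => wx.
  have := modulusD (w x) (s - w x).
  rewrite addrC subrK s1 -(modulusN (s - _)) opprB.
  by lra.
have half_out (w : pfun K mu p1) x : ~ E N x -> H w x -> H (w - one) x.
  move=> Ex wx; suff : 2^-1 <= modulus (w x - one x) by [].
  by rewrite oneF// subr0.
have half_le (w : set T) (g : pfun K mu p1) : measurable w ->
    w `<=` H g -> (pnorm mu p g <= r%:E)%E -> (mu w <= e%:E)%E.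
  move=> mw wg gr; apply: (@le_trans _ _ (mu (H g))).
    by apply: le_measure; rewrite ?inE.
  by apply: le_trans (muH _ gr) _; rewrite lee_fin; lra.
have mB : measurable (E N `&` (H u `&` H un)).
  by apply: measurableI => //; exact: measurableI.
exists n, (E N `&` (H u `&` H un)); split; split=> //.
- exact: leq_ltn_trans mn.
- apply: (@le_trans _ _ (mu (H (u - one) `|` H (un - one)))).
    apply: le_measure; rewrite ?inE.
    + exact: measurableD.
    + by apply: measurableU; exact: mH.
    move=> x [Ex nB]; have [ux|ux] := pselect (H u x).
      by right; apply: half_in => // unx; exact: nB.
    by left; exact: half_in.
  apply: le_trans (measureU2 _ _ _) _; [exact: mH|exact: mH|].
  by rewrite [e]splitr EFinD; apply: leeD; exact: muH.
(* For y in f^n(B) the value of u o f^n at f^-n(y) is u(y), so |u(y)| >= 1/2; y lies outside [E N]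
   because f^-n(y) lies in it. *)
- apply: (half_le _ (u - one)) => //; first exact: mpre.
  move=> y [Ey [_]]; rewrite /H /= iterKV => uy.
  by apply: half_out => // Ey'; have := mN _ _ mn Ey; rewrite iterKV; exact.
(* For y in f^-n(B), |u(f^n(y))| >= 1/2; if y were in [E N], then f^n(y) would lie outside [E N],
   yet it lies in B. *)
- apply: (half_le _ (un - one)) => //; first exact: mpre.
  move=> y [Ey [uy _]]; apply: half_out => // Ey'; exact: mN _ _ mn Ey' Ey.
Qed.

End criterion.

(** * Dissipative systems *)

Section wandering_exhaustion.
Context d (T : measurableType d) (f finv : T -> T) (W : set T).
Hypothesis finvK : cancel finv f.

Let D k := zimage f finv k W.

(** [Negz i] stands for -(i + 1), so the indices k that occur are those with -N <= k < N. *)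
Definition wandering_exhaustion N :=
  \bigcup_(i in `I_N) (D (Posz i) `|` D (Negz i)).

Lemma wandering_exhaustion_homo :
  {homo wandering_exhaustion : m n / (m <= n)%N >-> m `<=` n}.
Proof.
by move=> m n mn x [i /= im Dx]; exists i => //=; exact: leq_trans mn.
Qed.

Lemma wandering_exhaustion_cover : \bigcup_(k in [set: int]) D k = setT ->
  forall x, exists N, wandering_exhaustion N x.
Proof.
move=> DT x; have : [set: T] x by [].
rewrite -DT => -[[i|i] _ Dx]; exists i.+1; exists i => //=; [by left|by right].
Qed.

(** Negative indices are iterates of [finv], and f undoes one of them; the passage from -1 to 0 is a
    case of its own. *)
Let zimage_succ k x : D k x -> D (k + 1) (f x).
Proof.
case: k => k.
  by move=> [w Ww <-]; rewrite (_ : Posz k + 1 = Posz k.+1); [exists w|lia].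
case: k => [|k] [w Ww <-].
  by rewrite (_ : Negz 0 + 1 = 0)//; exists w => //=; rewrite finvK.
rewrite (_ : Negz k.+1 + 1 = Negz k); last lia.
by exists w => //; rewrite [in RHS]iterS finvK.
Qed.

Let zimage_shift n k x : D k x -> D (k + n%:Z) (iter n f x).
Proof.
move=> Dx; elim: n => [|n ih]; first by rewrite addr0.
rewrite (_ : k + n.+1%:Z = (k + n%:Z) + 1); last lia.
exact: zimage_succ.
Qed.

(** Disjointness makes the index of a point unique. Indices in [-N, N) differ by less than 2N, so a
    shift by n > 2N leaves this range. *)
Lemma wandering_exhaustion_wandering : trivIset setT D ->
  forall N, exists m, forall n x, (m < n)%N ->
    wandering_exhaustion N x -> ~ wandering_exhaustion N (iter n f x).
Proof.
move=> tD N; exists (N + N)%N => n x Nn.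
have range y : wandering_exhaustion N y ->
    exists2 k : int, D k y & (- N%:Z <= k < N%:Z).
  by move=> [i /= iN [Dy|Dy]]; [exists (Posz i)|exists (Negz i)] => //; lia.
move=> /range[k /(zimage_shift n) Dk kN] /range[j Dj jN].
have : k + n%:Z = j by apply: tD => //; exists (iter n f x).
by lia.
Qed.

Context (R : realType) (mu : {measure set T -> \bar R}).
Hypothesis fK : cancel f finv.
Hypotheses (hf : bounded_preimage mu f) (hfinv : bounded_preimage mu finv).
Hypotheses (mW : measurable W) (finW : (mu W < +oo)%E).

(** Turns images into preimages under the inverse iterates, whose measurability and finite measure
    follow from the preimage bounds. *)
Let image_iter (g h : T -> T) n : cancel g h -> cancel h g ->
  iter n g @` W = iter n h @^-1` W.
Proof.
move=> gK hK; have gnK : cancel (iter n g) (iter n h).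
  by elim: n => // n ih x; rewrite iterSr iterS gK ih.
have hnK : cancel (iter n h) (iter n g).
  by elim: n {gnK} => // n ih x; rewrite iterSr iterS hK ih.
apply/seteqP; split => [_ [x Wx <-]|x Wx] /=; first by rewrite gnK.
by exists (iter n h x).
Qed.

Let preimage_finite (g : T -> T) n : bounded_preimage mu g ->
  measurable (iter n g @^-1` W) /\ (mu (iter n g @^-1` W) < +oo)%E.
Proof.
move=> hg; have [mg [c c0 cW]] := bounded_preimage_iter hg n; split.
  by rewrite -[X in measurable X]setTI; exact: mg.
by rewrite (le_lt_trans (cW _ mW))// lte_mul_pinfty// lee_fin ltW.
Qed.

Let D_finite k : measurable (D k) /\ (mu (D k) < +oo)%E.
Proof.
case: k => n; rewrite /D /zimage.
  by rewrite (image_iter n fK finvK); exact: preimage_finite.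
by rewrite (image_iter n.+1 finvK fK); exact: preimage_finite.
Qed.

Lemma measurable_wandering_exhaustion N : measurable (wandering_exhaustion N).
Proof.
by apply: bigcup_measurable => i _; apply: measurableU; exact: (D_finite _).1.
Qed.

Lemma wandering_exhaustion_lty N : (mu (wandering_exhaustion N) < +oo)%E.
Proof.
elim: N => [|N ih].
  by rewrite /wandering_exhaustion II0 bigcup_set0 measure0.
rewrite /wandering_exhaustion IIS bigcup_setU bigcup_set1.
apply: le_lt_trans (measureU2 _ _ _) _.
- exact: measurable_wandering_exhaustion.
- by apply: measurableU; exact: (D_finite _).1.
apply: lte_add_pinfty; first exact: ih.
apply: le_lt_trans (measureU2 _ _ _) _; [exact: (D_finite _).1..|].
by apply: lte_add_pinfty; exact: (D_finite _).2.
Qed.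

End wandering_exhaustion.

(** * The equivalence for dissipative composition operators *)

Theorem theorem2p2 (R : realType) (K : scalars)
    (d : measure_display) (X : measurableType d)
    (mu : {measure set X -> \bar R}) (p : R) (p1 : 1 <= p)
    (f finv : X -> X)
    (sigma_fin : sigma_finite [set: X] mu)
    (Lp_separable : separable (Lp K mu p1))
    (fK : cancel f finv) (finvK : cancel finv f)
    (hf : bounded_preimage mu f) (hfinv : bounded_preimage mu finv)
    (f_dissipative : dissipative mu f finv) :
  hypercyclic (comp_op K p1 hf) <-> recurrent (comp_op K p1 hf).
Proof.
split; first exact: hypercyclic_recurrent.
move=> rec; have [W [mW _ finW tW cW]] := f_dissipative.
(* Transitivity is enough, as L^p is separable and complete and the operator is continuous. *)
apply: transitive_hypercyclic => //; first exact: comp_op_continuous.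
have mE := measurable_wandering_exhaustion finvK fK hf hfinv mW finW.
apply: (escaping_exhaustion_transitive fK hf hfinv mE).
- exact: wandering_exhaustion_homo.
- exact: wandering_exhaustion_cover.
- apply: (recurrent_escaping_exhaustion finvK hfinv mE _ _ rec).
  + exact: wandering_exhaustion_lty.
  + exact: (wandering_exhaustion_wandering finvK tW).
Qed.
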